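(* Let $V$ be a non-zero finite-dimensional real $\mathbb{Z}$-graded vector space with $r_j=\dim V_j$, equipped with a degree $\ell$ metric $g$, where $\ell=-2k$ with $k$ odd. Let $i_\bullet\in\mathbb{N}_0$ be such that $r_{k+i_\bullet}\ne0$ and $r_{k+i}=0$ for all $i>i_\bullet$. For $A\in\mathrm{O}(V_\bullet,g)$ and $i\in\{0,\dots,i_\bullet\}$ let $\mathbb{A}_{(i)}\in\mathrm{GL}(r_{k+i},\mathbb{R})$ be the matrix of $A_{k+i}:V_{k+i}\to V_{k+i}$ with respect to the basis of $V_{k+i}$ taken from the standard total basis described in the context. Then the map $A\mapsto(\mathbb{A}_{(i)})_{i=0}^{i_\bullet}$ defines a Lie group isomorphism $$\mathrm{O}(V_\bullet,g)\cong\mathrm{Sp}(r_k)\times\prod_{i=1}^{i_\bullet}\mathrm{GL}(r_{k+i},\mathbb{R}),$$ where $\mathrm{Sp}(r_k)$ is the group of real $r_k\times r_k$ matrices $\mathbb{A}$ with $\mathbb{A}^T\Omega\mathbb{A}=\Omega$, $\Omega$ being the standard symplectic form on $\mathbb{R}^{r_k}$.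
   Context: A graded vector space is a sequence $V=(V_j)_{j\in\mathbb{Z}}$ of real vector spaces with $\sum_j\dim V_j<\infty$. $V^*$ is the graded dual, $(V^* )_j=(V_{-j})^*$. A degree $\ell$ metric on $V$ is a bilinear map $g:V\times V\to\mathbb{R}$ with $g(v,w)=0$ unless $|v|+|w|+\ell=0$, $g(v,w)=(-1)^{(|v|+\ell)(|w|+\ell)}g(w,v)$, and such that the degree $\ell$ map $g:V\to V^*$ (same symbol), $[g(v)](w):=(-1)^{(|v|+1)\ell}g(v,w)$, is an isomorphism, i.e. all components $g_j:V_j\to(V_{-(j+\ell)})^*$ are isomorphisms. Hence $r_j=r_{-(j+\ell)}$ for all $j$. $\mathrm{GL}(V_\bullet)\cong\prod_j\mathrm{GL}(V_j)$ is the Lie group of invertible degree zero linear maps $A=(A_j)_{j\in\mathbb{Z}}$ of $V$, and $\mathrm{O}(V_\bullet,g)=\{A\in\mathrm{GL}(V_\bullet)\mid A^TgA=g\}$, i.e. $(A_{-(j+\ell)})^Tg_jA_j=g_j$ for all $j$ (it is the underlying Lie group of the graded orthogonal group $\mathrm{O}(V,g)$). Standard total basis: for $\ell=-2k$, $k$ odd ($r_k$ is then even), a total basis (union of bases of the $V_j$) of $V$ consisting of: for $i\in\{1,\dots,i_\bullet\}$, a basis $(t^{(i)}_\alpha)_{\alpha=1}^{r_{k+i}}$ of $V_{k+i}$ and a basis $(\overline{t}^{(i)}_\beta)_{\beta=1}^{r_{k+i}}$ of $V_{k-i}$; and a basis $(t^{(0)}_\alpha)_{\alpha=1}^{r_k/2}\cup(\overline{t}^{(0)}_\beta)_{\beta=1}^{r_k/2}$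 of $V_k$; such that $g(t^{(i)}_\alpha,\overline{t}^{(i)}_\beta)=\delta_{\alpha\beta}$ for all $i\in\{0,\dots,i_\bullet\}$, and all other values of $g$ on basis vectors are zero or obtained by graded symmetry. Such a basis exists and one is fixed. For $i\ge1$, $A_{k+i}(t^{(i)}_\alpha)=\sum_\beta[\mathbb{A}_{(i)}]^\beta{}_\alpha t^{(i)}_\beta$; $\mathbb{A}_{(0)}$ is the matrix of $A_k$ in the basis $(t^{(0)}_\alpha)\cup(\overline{t}^{(0)}_\beta)$, in which $g|_{V_k\times V_k}$ has the matrix $\Omega$. Groups of $0\times0$ matrices are trivial. *)

(* Defs.v *)
From HB Require Import structures.
From mathcomp Require Import all_boot all_order all_algebra.
From mathcomp Require Import all_classical all_reals all_analysis.

Set Implicit Arguments.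
Unset Strict Implicit.
Unset Printing Implicit Defensive.

Import Order.TTheory GRing.Theory Num.Theory.
Import numFieldNormedType.Exports.
Local Open Scope classical_set_scope.
Local Open Scope ring_scope.

Definition dprod (I : Type) (W : I -> Type) : Type := forall i, W i.

HB.instance Definition _ I (W : I -> Type) := gen_eqMixin (dprod W).
HB.instance Definition _ I (W : I -> Type) := gen_choiceMixin (dprod W).

Section DProdZmodule.
Variables (I : Type) (W : I -> zmodType).
Implicit Types f g h : dprod W.

Let dzero : dprod W := fun=> 0.
Let dopp f : dprod W := fun i => - f i.
Let dadd f g : dprod W := fun i => f i + g i.

Let daddA : associative dadd.
Proof. by move=> f g h; apply: functional_extensionality_dep => i; exact: addrA. Qed.

Let daddC : commutative dadd.
Proof. by move=> f g; apply: functional_extensionality_dep => i; exact: addrC. Qed.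

Let dadd0 : left_id dzero dadd.
Proof. by move=> f; apply: functional_extensionality_dep => i; exact: add0r. Qed.

Let daddN : left_inverse dzero dopp dadd.
Proof. by move=> f; apply: functional_extensionality_dep => i; exact: addNr. Qed.

HB.instance Definition _ :=
  GRing.isZmodule.Build (dprod W) daddA daddC dadd0 daddN.

End DProdZmodule.

Section DProdLmodule.
Variables (R : pzRingType) (I : Type) (W : I -> lmodType R).
Implicit Types f g : dprod W.

Let dscale (a : R) f : dprod W := fun i => a *: f i.

Let dscaleA a b f : dscale a (dscale b f) = dscale (a * b) f.
Proof. by apply: functional_extensionality_dep => i; exact: scalerA. Qed.

Let dscale1 : left_id 1 dscale.
Proof. by move=> f; apply: functional_extensionality_dep => i; exact: scale1r. Qed.

Let dscaleDr : right_distributive dscale +%R.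
Proof. by move=> a f g; apply: functional_extensionality_dep => i; exact: scalerDr. Qed.

Let dscaleDl f : {morph dscale^~ f : a b / a + b}.
Proof. by move=> a b; apply: functional_extensionality_dep => i; exact: scalerDl. Qed.

HB.instance Definition _ :=
  GRing.Zmodule_isLmodule.Build R (dprod W) dscaleA dscale1 dscaleDr dscaleDl.

End DProdLmodule.

Fixpoint Ck (R : realType) (V W : normedModType R) (U : set V) (k : nat)
    (f : V -> W) : Prop :=
  match k with
  | 0%N => forall x, U x -> {for x, continuous f}
  | k'.+1 => (forall x, U x -> differentiable f x) /\
             forall v : V, Ck U k' (fun x => 'D_v f x)
  end.

Definition Cinfty (R : realType) (V W : normedModType R) (U : set V)
  (f : V -> W) : Prop := forall k, Ck U k f.

(* Smoothness on a subset of a finite-dimensional vector space, in the sense of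
   local smooth extensions.  Between embedded submanifolds of vector spaces
   this is smoothness for the manifold structures.  The spaces carry no
   topology; it is read through injective linear coordinates into some R^n,
   which exist exactly in finite dimension and whose choice is immaterial. *)
Definition smooth_on (R : realType) (E F : lmodType R) (S : set E)
    (f : E -> F) : Prop :=
  exists (n m : nat) (c : {linear E -> 'rV[R]_n}) (d : {linear F -> 'rV[R]_m}),
    [/\ injective c, injective d &
        forall x, S x -> exists (U : set 'rV[R]_n) (phi : 'rV[R]_n -> 'rV[R]_m),
          [/\ open U, U (c x), Cinfty U phi &
              forall y, S y -> U (c y) -> d (f y) = phi (c y)]].

Record linear_group (R : realType) (E : lmodType R) := LinearGroup {
  lg_mul : E -> E -> E;
  lg_one : E;
  lg_set : set E
}.

Definition lg_units (R : realType) (E : lmodType R) (G : linear_group E)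
    : set E :=
  [set x | exists y, lg_mul G x y = lg_one G /\ lg_mul G y x = lg_one G].

(* A closed subgroup of the group of units of a finite-dimensional associative
   unital algebra; by the closed subgroup theorem it is an embedded Lie
   subgroup, and this is the Lie group structure it carries. *)
Record linear_lie_group (R : realType) (E : lmodType R)
    (G : linear_group E) : Prop := {
  llg_mulDl : forall (a : R) (x y z : E),
    lg_mul G (a *: x + y) z = a *: lg_mul G x z + lg_mul G y z;
  llg_mulDr : forall (a : R) (x y z : E),
    lg_mul G x (a *: y + z) = a *: lg_mul G x y + lg_mul G x z;
  llg_mulA : associative (lg_mul G);
  llg_mul1l : left_id (lg_one G) (lg_mul G);
  llg_mul1r : right_id (lg_one G) (lg_mul G);
  llg_one : lg_set G (lg_one G);
  llg_mul : forall x y, lg_set G x -> lg_set G y -> lg_set G (lg_mul G x y);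
  llg_inv : forall x, lg_set G x -> exists y,
    [/\ lg_set G y, lg_mul G x y = lg_one G & lg_mul G y x = lg_one G];
  llg_closed : exists (n : nat) (c : {linear E -> 'rV[R]_n})
      (C : set 'rV[R]_n),
    [/\ injective c, closed C & lg_set G = lg_units G `&` c @^-1` C]
}.

Definition lie_group_isomorphism (R : realType) (E F : lmodType R)
    (G : linear_group E) (H : linear_group F) (f : E -> F) : Prop :=
  [/\ linear_lie_group G /\ linear_lie_group H,
      set_bij (lg_set G) (lg_set H) f,
      forall x y, lg_set G x -> lg_set G y ->
        f (lg_mul G x y) = lg_mul H (f x) (f y),
      smooth_on (lg_set G) f &
      exists f' : F -> E,
        (forall x, lg_set G x -> f' (f x) = x) /\ smooth_on (lg_set H) f'].

(* A [vectType] is finite-dimensional, so this says that the total dimension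
   is finite. *)
Definition finite_graded (R : realType) (V : int -> vectType R) : Prop :=
  finite_set [set j | \dim {: V j} != 0%N].

Definition gdual (R : realType) (V : int -> vectType R) (j : int)
  : vectType R := 'Hom(V (- j), R^o).

Definition deg0_end (R : realType) (V : int -> vectType R) : lmodType R :=
  dprod (fun j => 'End(V j)).

(* Bilinear maps V x V -> R, componentwise and curried. *)
Definition gform (R : realType) (V : int -> vectType R) : Type :=
  forall i j : int, 'Hom(V i, 'Hom(V j, R^o)).

Definition gflat (R : realType) (V : int -> vectType R) (l : int)
    (g : gform V) (j : int) : 'Hom(V j, gdual V (j + l)) :=
  ((-1) ^ ((j + 1) * l) : R) *: g j (- (j + l)).

Record graded_metric (R : realType) (V : int -> vectType R) (l : int)
    (g : gform V) : Prop := {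
  gm_degree : forall i j (v : V i) (w : V j), i + j + l != 0 -> g i j v w = 0;
  gm_sym : forall i j (v : V i) (w : V j),
    g i j v w = ((-1) ^ ((i + l) * (j + l)) : R) * g j i w v;
  gm_iso : forall j, bijective (gflat l g j)
}.

Definition lfun_dual (R : realType) (U W : vectType R) (f : 'Hom(U, W))
    : 'Hom('Hom(W, R^o), 'Hom(U, R^o)) :=
  linfun (fun xi : 'Hom(W, R^o) => (xi \o f)%VF).

Lemma lfun_dualE (R : realType) (U W : vectType R) (f : 'Hom(U, W))
  (xi : 'Hom(W, R^o)) : lfun_dual f xi = (xi \o f)%VF.
Proof.
pose h (xi : 'Hom(W, R^o)) := (xi \o f)%VF.
have hl : linear h by move=> a x y; rewrite /h comp_lfunDl comp_lfunZl.
pose hL := HB.pack_for {linear 'Hom(W, R^o) -> 'Hom(U, R^o)} h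
  (GRing.isLinear.Build _ _ _ _ h hl).
by rewrite /lfun_dual -/h (lfunE hL).
Qed.

Definition GL_graded (R : realType) (V : int -> vectType R)
    : set (deg0_end V) :=
  [set A | forall j, bijective (A j)].

Definition O_graded (R : realType) (V : int -> vectType R) (l : int)
    (g : gform V) : linear_group (deg0_end V) :=
  @LinearGroup R (deg0_end V)
    (fun A B j => (A j \o B j)%VF)
    (fun j => \1%VF)
    [set A | GL_graded A /\
       forall j, (lfun_dual (A (- (j + l)))%R \o gflat l g j \o A j)%VF
                 = gflat l g j].

(* For a metric g of degree -2k with k odd; m is the largest i with r_(k+i)
   nonzero.  The index i = 1, ..., m is encoded as [i.+1] with [i : 'I_m].
   The values of g not listed are zero for degree reasons or determined by
   graded symmetry. *)
Record standard_basis (R : realType) (V : int -> vectType R) (g : gform V)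
    (k : int) (m : nat) := StandardBasis {
  sb_t : forall i : 'I_m,
    (\dim {: V (k + i.+1%:Z)}).-tuple (V (k + i.+1%:Z));
  sb_tb : forall i : 'I_m,
    (\dim {: V (k + i.+1%:Z)}).-tuple (V (k - i.+1%:Z));
  sb_t0 : ((\dim {: V k})./2).-tuple (V k);
  sb_tb0 : ((\dim {: V k})./2).-tuple (V k);
  sb_t_basis : forall i : 'I_m, basis_of {: V (k + i.+1%:Z)} (sb_t i);
  sb_tb_basis : forall i : 'I_m, basis_of {: V (k - i.+1%:Z)} (sb_tb i);
  sb_0_basis : basis_of {: V k} (sb_t0 ++ sb_tb0);
  sb_pair : forall (i : 'I_m) a b,
    g (k + i.+1%:Z) (k - i.+1%:Z) (tnth (sb_t i) a) (tnth (sb_tb i) b)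
    = (a == b)%:R;
  sb_pair0 : forall a b, g k k (tnth sb_t0 a) (tnth sb_tb0 b) = (a == b)%:R;
  sb_t0_isotropic : forall a b, g k k (tnth sb_t0 a) (tnth sb_t0 b) = 0;
  sb_tb0_isotropic : forall a b, g k k (tnth sb_tb0 a) (tnth sb_tb0 b) = 0
}.

Definition endo_mx (R : realType) (W : vectType R) (n : nat)
    (e : n.-tuple W) (f : 'End(W)) : 'M[R]_n :=
  \matrix_(b < n, a < n) coord e b (f (tnth e a)).

Definition Omega (R : realType) (h : nat) : 'M[R]_(h + h) :=
  block_mx 0 1%:M (- 1%:M) 0.

(* Since r_k is even, [(r_k)./2 + (r_k)./2] is r_k. *)
Definition blocks (R : realType) (V : int -> vectType R) (k : int) (m : nat)
    : lmodType R :=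
  ('M[R]_((\dim {: V k})./2 + (\dim {: V k})./2) *
   dprod (fun i : 'I_m => 'M[R]_(\dim {: V (k + i.+1%:Z)%R})))%type.

Definition Sp_x_GL (R : realType) (V : int -> vectType R) (k : int) (m : nat)
    : linear_group (blocks V k m) :=
  @LinearGroup R (blocks V k m)
    (fun B C => (B.1 *m C.1, fun i => B.2 i *m C.2 i))
    (1%:M, fun i => 1%:M)
    [set B | B.1^T *m Omega R _ *m B.1 = Omega R _ /\
             forall i, B.2 i \in unitmx].

Definition block_matrices (R : realType) (V : int -> vectType R) (g : gform V)
    (k : int) (m : nat) (b : standard_basis g k m) (A : deg0_end V)
    : blocks V k m :=
  (endo_mx [tuple of sb_t0 b ++ sb_tb0 b] (A k),
   fun i => endo_mx (sb_t b i) (A (k + i.+1%:Z))).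

(* Main.v *)
(** In every degree, [A] in [O(V, g)] preserves the pairing of [V_j] with
    [V_(2k-j)].  Relative to the standard basis the Gram matrix of this pairing
    is the identity for [j = k + i], [i > 0], so that the matrix of [A_(k-i)] is
    the inverse transpose of that of [A_(k+i)], which is arbitrary; for [j = k]
    it is [Omega], because [k] odd makes [g] skew-symmetric on [V_k].  All the
    other components vanish.  The map is thus bijective, it is linear, and its
    inverse is rational in the coordinates, with nonvanishing denominators on
    the group; rational functions are smooth because their directional
    derivatives are again rational. *)

From HB Require Import structures.
Require Import Defs.
From mathcomp Require Import all_boot all_order all_algebra.
From mathcomp Require Import all_classical all_reals all_analysis.
From mathcomp Require Import zify.

Import GRing.Theory Num.Theory.
Import numFieldNormedType.Exports passmx.
Local Open Scope classical_set_scope.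
Local Open Scope ring_scope.

Set Implicit Arguments.
Unset Strict Implicit.
Unset Printing Implicit Defensive.

(** * Rational functions, their directional derivatives and their smoothness *)

Section Rational.
Context {R : realType}.

(** Expressions in the linear functionals of [E], so that no coordinates have to be chosen. [U] only
    constrains the denominators, which must not vanish there. *)
Inductive rational {E : lmodType R} (U : set E) : (E -> R) -> Prop :=
| rational_cst (a : R) : rational U (fun=> a)
| rational_lin (f : {linear E -> R^o}) : rational U f
| rational_add f g : rational U f -> rational U g ->
    rational U (fun x => f x + g x)
| rational_mul f g : rational U f -> rational U g ->
    rational U (fun x => f x * g x)
| rational_inv f : rational U f -> (forall x, U x -> f x != 0) ->
    rational U (fun x => (f x)^-1).

Lemma rational_sum {E : lmodType R} (U : set E) (I : Type) (r : seq I)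
  (P : pred I) (f : I -> E -> R) : (forall i, rational U (f i)) ->
  rational U (fun x => \sum_(i <- r | P i) f i x).
Proof.
move=> rf; elim: r => [|i r IHr].
  by under eq_fun do rewrite big_nil; exact: rational_cst.
under eq_fun do rewrite big_cons.
by case: (P i) => //; exact: rational_add.
Qed.

Lemma rational_prod {E : lmodType R} (U : set E) (I : Type) (r : seq I)
  (P : pred I) (f : I -> E -> R) : (forall i, rational U (f i)) ->
  rational U (fun x => \prod_(i <- r | P i) f i x).
Proof.
move=> rf; elim: r => [|i r IHr].
  by under eq_fun do rewrite big_nil; exact: rational_cst.
under eq_fun do rewrite big_cons.
by case: (P i) => //; exact: rational_mul.
Qed.

Lemma rational_comp {E E' : lmodType R} (U : set E) (h : {linear E' -> E})
  (f : E -> R) : rational U f -> rational (h @^-1` U) (f \o h).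
Proof.
elim => {f} [a|f|f g _ rf _ rg|f g _ rf _ rg|f _ rf f0].
- exact: rational_cst.
- exact: (@rational_lin _ _ (f \o h)).
- exact: rational_add.
- exact: rational_mul.
- by apply: rational_inv => // x /f0.
Qed.

Lemma rational_det {E : lmodType R} (U : set E) n (M : E -> 'M[R]_n) :
  (forall i j, rational U (fun x => M x i j)) ->
  rational U (fun x => \det (M x)).
Proof.
move=> rM; apply: rational_sum => s; apply: rational_mul.
  exact: rational_cst.
by apply: rational_prod.
Qed.

(** The entries of the adjugate are signed minors, polynomial in those of [M x]; the determinant is
    the only new denominator. *)
Lemma rational_invmx {E : lmodType R} (U : set E) n (M : E -> 'M[R]_n) i j :
  (forall i j, rational U (fun x => M x i j)) ->
  (forall x, U x -> \det (M x) != 0) ->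
  rational U (fun x => ((\det (M x))^-1 *: \adj (M x)) i j).
Proof.
move=> rM M0; under eq_fun do rewrite !mxE.
apply: rational_mul; first by apply: rational_inv => //; exact: rational_det.
apply: rational_mul; first exact: rational_cst.
by apply: rational_det => k l; under eq_fun do rewrite !mxE.
Qed.


Lemma linear_rV_continuous n (f : {linear 'rV[R]_n -> R^o}) : continuous f.
Proof.
pose h i := (fun x : 'rV[R]_n => x 0 i *: f (delta_mx 0 i)) : 'rV[R]_n -> R^o.
have -> : (f : 'rV[R]_n -> R^o) = \sum_i h i.
  apply/funext => x; rewrite fct_sumE [in LHS](row_sum_delta x) linear_sum.
  by apply: eq_bigr => i _; rewrite linearZ.
move=> x; apply: differentiable_continuous.
apply: differentiable_sum => i.
apply: differentiableZl; exact: differentiable_coord.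
Qed.

(** The first-order expansion of [f] at [a] is also one of [g], and the differential is unique. This
    serves functions known only through a formula near each point. *)
Lemma near_eq_differentiable (V W : normedModType R) (f g : V -> W) a :
  {near a, f =1 g} -> differentiable f a -> differentiable g a.
Proof.
move=> fg /diff_locallyP[cf /eqaddoP fE].
have fga : f a = g a := nbhs_singleton fg.
have gE : g \o shift a = cst (g a) + 'd f a +o_ 0 id.
  apply/eqaddoP => e e0; near=> x.
  have -> : (g \o shift a - (cst (g a) + 'd f a)) x
          = (f \o shift a - (cst (f a) + 'd f a)) x.
    rewrite !fctE /= fga; congr (_ - _); apply/esym.
    (* [fg] is a statement near [a]; translation makes it one about increments near 0. *)
    near: x; have := fg; rewrite (near_shift 0) /= subr0; exact.
  by near: x; exact: fE.
by apply/diff_locallyP; rewrite (diff_unique cf gE).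
Unshelve. all: by end_near. Qed.

(** Induction on the expression, by the sum, product and inverse rules. The derivative is matched on
    [U] only, since elsewhere a denominator may vanish. *)
Lemma rational_derive n (U : set 'rV[R]_n) f : rational U f ->
  (forall x, U x -> differentiable (f : _ -> R^o) x) /\
  forall v, exists2 g, rational U g & forall x, U x -> 'D_v f x = g x.
Proof.
elim => {f} [a|f|f g rf [df ef] rg [dg eg]|f g rf [df ef] rg [dg eg]|f rf [df ef] f0].
- split=> [x _|v]; first exact: differentiable_cst.
  exists (fun=> 0) => [|x _]; first exact: rational_cst.
  exact: derive_cst.
- have df x : differentiable f x.
    by apply: linear_differentiable; exact: linear_rV_continuous.
  split=> [x _|v]; first exact: df.
  exists (fun=> f v) => [|x _]; first exact: rational_cst.
  by rewrite deriveE// diff_lin//; exact: linear_rV_continuous.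
- split=> [x Ux|v]; first by apply: differentiableD; [exact: df|exact: dg].
  have [f' rf' f'E] := ef v; have [g' rg' g'E] := eg v.
  exists (fun x => f' x + g' x) => [|x Ux]; first exact: rational_add.
  rewrite -f'E// -g'E//; apply: deriveD.
    exact/diff_derivable/df.
  exact/diff_derivable/dg.
- split=> [x Ux|v]; first by apply: differentiableM; [exact: df|exact: dg].
  have [f' rf' f'E] := ef v; have [g' rg' g'E] := eg v.
  exists (fun x => f x * g' x + g x * f' x) => [|x Ux].
    by apply: rational_add; exact: rational_mul.
  rewrite -f'E// -g'E//; apply: deriveM.
    exact/diff_derivable/df.
  exact/diff_derivable/dg.
- split=> [x Ux|v]; first by apply: differentiableV; [exact: df|exact: f0].
  have [f' rf' f'E] := ef v.
  (* The rule [(1/f)' = - f' / f^2]; the denominator [f * f] is admissible because [f] has no zero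
     on [U]. *)
  exists (fun x => (-1) * ((f x * f x)^-1 * f' x)) => [|x Ux].
    apply: rational_mul; first exact: rational_cst.
    apply: rational_mul => //; apply: rational_inv; first exact: rational_mul.
    by move=> x /f0 fx; rewrite mulf_neq0.
  rewrite -f'E// mulrA mulN1r -expr2; apply: deriveV; first exact: f0.
  exact/diff_derivable/df.
Qed.

(** Differentiation keeps the vectors [w i] and replaces the coefficients by other rational ones, so
    the induction on [k] closes. Derivatives satisfy such a formula only on [U], hence the form of
    the assumption on [h]; as [U] is open, it holds near each point of [U]. *)
Lemma rational_Ck n (W : normedModType R) (U : set 'rV[R]_n) p
    (w : 'I_p -> W) k (h : 'rV[R]_n -> W) (f : 'I_p -> 'rV[R]_n -> R) :
  open U -> (forall i, rational U (f i)) ->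
  (forall x, U x -> h x = \sum_i f i x *: w i) -> Ck U k h.
Proof.
move=> oU; elim: k h f => [|k IHk] h f rf hE.
all: pose F i := (fun x : 'rV[R]_n => f i x *: w i) : _ -> W.
all: have hF x : U x -> {near x, \sum_i F i =1 h}.
1,3: by move=> Ux; near=> y; rewrite fct_sumE hE//; near: y; exact: open_nbhs_nbhs.
all: have dF i x : U x -> differentiable (F i) x.
1,3: by move=> Ux; apply: differentiableZl; exact: (rational_derive (rf i)).1.
all: have dh x : U x -> differentiable h x.
1,3: by move=> Ux; apply: (near_eq_differentiable (hF x Ux));
  apply: differentiable_sum => i; exact: dF.
  by move=> x Ux; exact/differentiable_continuous/dh.
split=> // v.
have /choice[f' f'P] i : exists g, rational U g /\
    forall x, U x -> 'D_v (f i) x = g x.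
  by have [g] := (rational_derive (rf i)).2 v; exists g.
apply: (IHk _ f') => [i|x Ux]; first exact: (f'P i).1.
rewrite -(near_eq_derive _ (hF x Ux)) derive_sum; last first.
  by move=> i; exact/diff_derivable/dF.
apply: eq_bigr => i _; rewrite -(f'P i).2// !deriveE//; last 2 first.
- exact: (rational_derive (rf i)).1.
- exact: dF.
by rewrite diffZl//; exact: (rational_derive (rf i)).1.
Unshelve. all: by end_near. Qed.

End Rational.

(** * Finite-dimensional coordinates; closedness and smoothness read through them *)

Section Coordinates.
Context {R : realType}.

(** The retraction [c'], rather than mere injectivity of [c], transports functions on [E] to all of
    [R^n] as [f \o c']. *)
Definition coordinatized (E : lmodType R) := exists (n : nat)
  (c : {linear E -> 'rV[R]_n}) (c' : {linear 'rV[R]_n -> E}), cancel c c'.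

Lemma coordinatized_vect (W : vectType R) : coordinatized W.
Proof.
exists (\dim {:W}), (rVof (vbasis {:W}) : {linear W -> 'rV[R]_(\dim {:W})}),
  (vecof (vbasis {:W}) : {linear 'rV[R]_(\dim {:W}) -> W}).
exact/rVofK/vbasisP.
Qed.

Lemma coordinatized_prod (E F : lmodType R) :
  coordinatized E -> coordinatized F -> coordinatized (E * F)%type.
Proof.
move=> [n [c [c' cK]]] [p [d [d' dK]]].
pose f (x : E * F) := row_mx (c x.1) (d x.2).
pose f' (r : 'rV[R]_(n + p)) := (c' (lsubmx r), d' (rsubmx r)).
have fL : linear f by move=> a x y; rewrite /f !linearP scale_row_mx add_row_mx.
have fL' : linear f' by move=> a x y; rewrite /f' !linearP.
pose fl := HB.pack_for {linear (E * F)%type -> 'rV[R]_(n + p)} f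
  (GRing.isLinear.Build _ _ _ _ f fL).
pose fl' := HB.pack_for {linear 'rV[R]_(n + p) -> (E * F)%type} f'
  (GRing.isLinear.Build _ _ _ _ f' fL').
exists (n + p)%N, fl, fl' => -[x y].
by rewrite /= /f' /f /= row_mxKl row_mxKr cK dK.
Qed.

Definition dincl (I : eqType) (W : I -> lmodType R) (i : I) (x : W i) : dprod W :=
  eqtype.dfwith (fun j => 0 : W j) x.

Lemma dincl_in (I : eqType) (W : I -> lmodType R) (i : I) (x : W i) :
  dincl x i = x.
Proof. exact: dfwith_in. Qed.

Lemma dincl_out (I : eqType) (W : I -> lmodType R) (i j : I) (x : W i) :
  i != j -> dincl x j = 0.
Proof. exact: dfwith_out. Qed.

Lemma dincl_linear (I : eqType) (W : I -> lmodType R) (i : I) :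
  linear (@dincl I W i).
Proof.
move=> a x y; apply: functional_extensionality_dep => j.
transitivity (a *: dincl x j + dincl y j) => //.
have [<-|ij] := eqVneq i j; first by rewrite !dincl_in.
by rewrite !dincl_out// scaler0 addr0.
Qed.

HB.instance Definition _ (I : eqType) (W : I -> lmodType R) (i : I) :=
  GRing.isLinear.Build R _ _ _ (@dincl I W i) (@dincl_linear I W i).

(** Only the components indexed by [s] carry information, and their coordinates are concatenated. *)
Lemma coordinatized_dprod (I : eqType) (W : I -> lmodType R) (s : seq I) :
  (forall i, coordinatized (W i)) ->
  (forall i, i \notin s -> forall x : W i, x = 0) ->
  coordinatized (dprod W).
Proof.
move=> cW s0.
(* Asking to recover only the components in [s] frees the induction on [s] from the vanishing
   hypothesis. *)
suff [n [c [c' cK]]] : exists n (c : {linear dprod W -> 'rV[R]_n})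
   (c' : {linear 'rV[R]_n -> dprod W}),
   forall x i, i \in s -> c' (c x) i = x i.
  exists n, c, c' => x; apply: functional_extensionality_dep => i.
  by have [/cK->//|/s0 xi] := boolP (i \in s); rewrite [LHS]xi [RHS]xi.
elim: s {s0} => [|i s IHs] /=; first by exists 0%N, \0, \0.
have [n [c [c' cK]]] := IHs; have [p [d [d' dK]]] := cW i.
pose f (x : dprod W) := row_mx (d (x i)) (c x).
pose f' (r : 'rV[R]_(p + n)) : dprod W := fun j =>
  if j == i then dincl (d' (lsubmx r)) j else c' (rsubmx r) j.
have fL : linear f.
  by move=> a x y; rewrite /f [c _]linearP [d _]linearP scale_row_mx add_row_mx.
have fL' : linear f'.
  move=> a x y; apply: functional_extensionality_dep => j.
  transitivity (a *: f' x j + f' y j) => //.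
  by rewrite /f'; case: eqP => _; rewrite !linearP.
pose fl := HB.pack_for {linear dprod W -> 'rV[R]_(p + n)} f
  (GRing.isLinear.Build _ _ _ _ f fL).
pose fl' := HB.pack_for {linear 'rV[R]_(p + n) -> dprod W} f'
  (GRing.isLinear.Build _ _ _ _ f' fL').
exists (p + n)%N, fl, fl' => x j.
rewrite inE /= /f' /f /= row_mxKl row_mxKr dK; have [->|] /= := eqVneq j i.
  by move=> _; rewrite dincl_in.
by move=> _ /cK.
Qed.

(** Testing on all linear functionals avoids coordinates on [F] and makes composition with linear
    maps immediate. *)
Definition vrational {E F : lmodType R} (U : set E) (f : E -> F) :=
  forall lam : {linear F -> R^o}, rational U (lam \o f).

Lemma vrational_lin {E F : lmodType R} (U : set E) (f : {linear E -> F}) :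
  vrational U f.
Proof. by move=> lam; exact: rational_lin. Qed.

Lemma vrational_add {E F : lmodType R} (U : set E) (f g : E -> F) :
  vrational U f -> vrational U g -> vrational U (fun x => f x + g x).
Proof.
move=> rf rg lam; rewrite /comp; under eq_fun do rewrite linearD.
exact: (rational_add (rf lam) (rg lam)).
Qed.

Lemma vrational_sum {E F : lmodType R} (U : set E) (I : Type) (r : seq I)
  (f : I -> E -> F) : (forall i, vrational U (f i)) ->
  vrational U (fun x => \sum_(i <- r) f i x).
Proof.
move=> rf lam; rewrite /comp; under eq_fun do rewrite linear_sum.
by apply: rational_sum => i; exact: rf.
Qed.

Lemma vrational_scale {E F : lmodType R} (U : set E) (q : E -> R) (w : F) :
  rational U q -> vrational U (fun x => q x *: w).
Proof.
move=> rq lam; rewrite /comp; under eq_fun do rewrite linearZ.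
apply: rational_mul => //; exact: rational_cst.
Qed.

Lemma vrational_linl {E F F' : lmodType R} (U : set E) (f : E -> F)
  (h : {linear F -> F'}) : vrational U f -> vrational U (h \o f).
Proof. by move=> rf lam; exact: (rf (lam \o h)). Qed.

Lemma closed_zeros n (f : 'rV[R]_n -> R) :
  rational setT f -> closed (f @^-1` [set 0]).
Proof.
move=> /rational_derive[df _].
apply: (closed_comp (f := f : _ -> R^o)); last exact: closed_eq.
by move=> x _; apply: differentiable_continuous; exact: df.
Qed.

Definition mxentry m n (i : 'I_m) (j : 'I_n) (M : 'M[R]_(m, n)) : R^o := M i j.

Lemma mxentry_linear m n (i : 'I_m) (j : 'I_n) : linear (mxentry i j).
Proof. by move=> a x y; rewrite /mxentry !mxE. Qed.

HB.instance Definition _ m n (i : 'I_m) (j : 'I_n) :=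
  GRing.isLinear.Build R _ _ _ (mxentry i j) (mxentry_linear i j).

(** In coordinates the locus [q != 0] is open, since [q] is continuous. There [f] itself gives a
    single rational extension, which serves at every point of [S]. *)
Lemma vrational_smooth {E F : lmodType R} (S : set E) (q : E -> R) (f : E -> F) :
  coordinatized E -> coordinatized F -> rational setT q ->
  S `<=` [set x | q x != 0] -> vrational [set x | q x != 0] f ->
  smooth_on S f.
Proof.
move=> [n [c [c' cK]]] [p [d [d' dK]]] rq Sq rf.
exists n, p, c, d; split; [exact: can_inj cK|exact: can_inj dK|].
move=> x Sx; exists (c' @^-1` [set x | q x != 0]), (d \o f \o c').
have oU : open (c' @^-1` [set x | q x != 0]).
  have := rational_comp c' rq; rewrite preimage_setT => /closed_zeros/closed_openC.
  by congr open; apply/seteqP; split=> y /= /eqP.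
split=> //; first by rewrite /= cK; exact: Sq.
  move=> k; apply: (@rational_Ck _ _ _ _ _ (fun i => delta_mx 0 i) k _
    (fun i => (mxentry 0 i \o d \o f) \o c')) => // [i|y _].
    by apply: rational_comp; exact: (rf (mxentry 0 i \o d)).
  exact: row_sum_delta.
by move=> y _ _ /=; rewrite cK.
Qed.

(** In coordinates each function of [Q] is continuous, so its zeros are closed, and so is any
    intersection of such sets. This gives the closedness demanded of both groups. *)
Lemma rational_closed (E : lmodType R) (Q : set (E -> R)) :
  coordinatized E -> Q `<=` rational setT ->
  exists (n : nat) (c : {linear E -> 'rV[R]_n}) (C : set 'rV[R]_n),
    [/\ injective c, closed C & c @^-1` C = [set x | forall q, Q q -> q x = 0]].
Proof.
move=> [n [c [c' cK]]] rQ.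
exists n, c, (\bigcap_(q in Q) ((q \o c') @^-1` [set 0])).
split; first exact: can_inj cK.
  apply: closed_bigI => q Qq.
  by apply: closed_zeros; have := rational_comp c' (rQ _ Qq); rewrite preimage_setT.
apply/seteqP; split=> x /= xQ q /xQ /=; rewrite cK//.
Qed.

End Coordinates.

(** * Endomorphisms and their matrices in a basis *)

Section EndoMatrix.
Context {R : realType} {W : vectType R} {n : nat} (e : n.-tuple W).
Hypothesis e_basis : basis_of {:W} e.

Definition unit_endo (b a : 'I_n) : 'End(W) :=
  linfun (fun v => coord e a v *: tnth e b).

Lemma unit_endoE b a v : unit_endo b a v = coord e a v *: tnth e b.
Proof.
pose h v := coord e a v *: tnth e b.
have hl : linear h by move=> c x y; rewrite /h linearP scalerDl scalerA.
pose hL := HB.pack_for {linear W -> W} h (GRing.isLinear.Build _ _ _ _ h hl).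
by rewrite /unit_endo -/h (lfunE hL).
Qed.

(** The inverse of [endo_mx], written as a combination of fixed endomorphisms so that it is rational
    as soon as the entries of [M] are. *)
Definition mx_endo (M : 'M[R]_n) : 'End(W) :=
  \sum_b \sum_a M b a *: unit_endo b a.

Lemma coord_tnth a b : coord e a (tnth e b) = (a == b)%:R.
Proof. by rewrite (tnth_nth 0) coord_free ?(basis_free e_basis)// eq_sym. Qed.

Lemma basis_expand v : v = \sum_b coord e b v *: tnth e b.
Proof.
rewrite [LHS](coord_basis e_basis) ?memvf//.
by apply: eq_bigr => b _; rewrite (tnth_nth 0).
Qed.

Lemma endo_mxE (f : 'End(W)) a : f (tnth e a) = \sum_b endo_mx e f b a *: tnth e b.
Proof. by rewrite [LHS]basis_expand; apply: eq_bigr => b _; rewrite mxE. Qed.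

Lemma eq_on_basis (X : vectType R) (f h : 'Hom(W, X)) :
  (forall a, f (tnth e a) = h (tnth e a)) -> f = h.
Proof.
move=> fh; apply/lfunP => v; rewrite (basis_expand v) !linear_sum.
by apply: eq_bigr => a _; rewrite !linearZ /= fh.
Qed.

Lemma endo_mx_linear : linear (@endo_mx R W n e).
Proof.
by move=> c f h; apply/matrixP => b a; rewrite !mxE !lfunE /= lfunE linearP.
Qed.

HB.instance Definition _ :=
  GRing.isLinear.Build R _ _ _ (@endo_mx R W n e) endo_mx_linear.

Lemma endo_mxK : cancel (@endo_mx R W n e) mx_endo.
Proof.
move=> f; apply: eq_on_basis => a; rewrite [RHS]endo_mxE /mx_endo sum_lfunE.
apply: eq_bigr => b _; rewrite sum_lfunE (bigD1 a)//= big1 => [|c ca].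
  by rewrite lfunE /= unit_endoE coord_tnth eqxx scale1r addr0.
by rewrite lfunE /= unit_endoE coord_tnth (negPf ca) scale0r scaler0.
Qed.

Lemma mx_endoK : cancel mx_endo (@endo_mx R W n e).
Proof.
move=> M; apply/matrixP => b a; rewrite !mxE /mx_endo sum_lfunE linear_sum.
rewrite (bigD1 b)//= [X in _ + X]big1 ?addr0 => [|c cb].
  rewrite sum_lfunE linear_sum (bigD1 a)//= [X in _ + X]big1 ?addr0 => [|c ca].
    by rewrite lfunE /= unit_endoE coord_tnth eqxx scale1r linearZ /= coord_tnth eqxx mulr1.
  by rewrite lfunE /= unit_endoE coord_tnth (negPf ca) scale0r scaler0 linear0.
rewrite sum_lfunE linear_sum big1// => d _.
rewrite lfunE /= unit_endoE !linearZ /= !coord_tnth.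
by rewrite [b == c]eq_sym (negPf cb) !mulr0.
Qed.

Lemma endo_mx_comp (f h : 'End(W)) : endo_mx e (f \o h)%VF = endo_mx e f *m endo_mx e h.
Proof.
apply/matrixP => b a; rewrite !mxE comp_lfunE endo_mxE !linear_sum.
by apply: eq_bigr => c _; rewrite !linearZ /= mulrC [endo_mx e f b c]mxE.
Qed.

Lemma endo_mx1 : endo_mx e \1%VF = 1%:M.
Proof. by apply/matrixP => b a; rewrite !mxE id_lfunE coord_tnth. Qed.

Lemma endo_mx_unit (f : 'End(W)) : (endo_mx e f \in unitmx) <-> bijective f.
Proof.
split=> [fu|bf].
  pose h := mx_endo (invmx (endo_mx e f)); exists h => v.
    rewrite -[v in RHS](@id_lfunE _ W) -comp_lfunE; congr (fun_of_lfun _ v).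
    by apply: (can_inj endo_mxK); rewrite endo_mx_comp endo_mx1 mx_endoK mulVmx.
  rewrite -[v in RHS](@id_lfunE _ W) -comp_lfunE; congr (fun_of_lfun _ v).
  by apply: (can_inj endo_mxK); rewrite endo_mx_comp endo_mx1 mx_endoK mulmxV.
have /lker0P/lker0_compVf fK := bij_inj bf.
have : endo_mx e (f^-1)%VF *m endo_mx e f = 1%:M.
  by rewrite -endo_mx_comp fK endo_mx1.
by case/mulmx1_unit.
Qed.

End EndoMatrix.

(** * Gram matrices of pairings, and rationality of bilinear expressions *)

Section Gram.
Context {R : realType} {W W' : vectType R} {n n' : nat}.
Context (e : n.-tuple W) (e' : n'.-tuple W').
Hypothesis e_basis : basis_of {:W} e.
Hypothesis e'_basis : basis_of {:W'} e'.
Context (G : 'Hom(W, 'Hom(W', R^o))).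

Definition gram_mx : 'M[R]_(n, n') :=
  \matrix_(a, b) (G (tnth e a) (tnth e' b) : R).

Lemma gram_mx_endo (f : 'End(W)) (f' : 'End(W')) a b :
  G (f (tnth e a)) (f' (tnth e' b))
  = ((endo_mx e f)^T *m gram_mx *m endo_mx e' f') a b.
Proof.
rewrite mxE (endo_mxE e'_basis) linear_sum; apply: eq_bigr => c _.
rewrite linearZ /= mulrC; congr (_ * _); rewrite mxE (endo_mxE e_basis).
rewrite linear_sum sum_lfunE; apply: eq_bigr => d _.
by rewrite linearZ lfunE /= !mxE.
Qed.

(** By bilinearity it suffices to compare values on basis vectors. Two different spaces are allowed,
    as needed for [V_(k+i)] and [V_(k-i)]. *)
Lemma gram_mx_invariant (f : 'End(W)) (f' : 'End(W')) :
  (forall v w, G (f v) (f' w) = G v w) <->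
  (endo_mx e f)^T *m gram_mx *m endo_mx e' f' = gram_mx.
Proof.
split=> [ff'|ff' v w].
  by apply/matrixP => a b; rewrite -gram_mx_endo ff' mxE.
rewrite (basis_expand e_basis v) !linear_sum !sum_lfunE.
apply: eq_bigr => a _; rewrite !linearZ !lfunE /=; congr (_ * _).
rewrite (basis_expand e'_basis w) !linear_sum; apply: eq_bigr => b _.
by rewrite !linearZ /= gram_mx_endo ff' mxE.
Qed.

End Gram.

(** Expanded in bases of [X] and [Y], this is a quadratic polynomial in linear functionals of
    [E]. *)
Lemma rational_bilinear {R : realType} {E : lmodType R} {X Y : vectType R}
  (U : set E) (G : 'Hom(X, 'Hom(Y, R^o))) (f : {linear E -> X})
  (h : {linear E -> Y}) : rational U (fun x => G (f x) (h x)).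
Proof.
have -> : (fun x => G (f x) (h x)) = (fun x =>
    \sum_a \sum_b (coord (vbasis {:X}) a (f x) * coord (vbasis {:Y}) b (h x)) *
      (G (tnth (vbasis {:X}) a) (tnth (vbasis {:Y}) b) : R)).
  apply/funext => x; rewrite [f x in LHS](basis_expand (vbasisP _)).
  rewrite linear_sum sum_lfunE; apply: eq_bigr => a _.
  rewrite linearZ lfunE /= [h x in LHS](basis_expand (vbasisP _)) linear_sum.
  rewrite scaler_sumr; apply: eq_bigr => b _; rewrite linearZ /=.
  exact: mulrA.
apply: rational_sum => a; apply: rational_sum => b.
apply: rational_mul; last exact: rational_cst.
apply: rational_mul.
  exact: (rational_lin U (coord (vbasis {:X}) a \o f)).
exact: (rational_lin U (coord (vbasis {:Y}) b \o h)).
Qed.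

Lemma vrational_mx_endo {R : realType} {E : lmodType R} {W : vectType R}
  (U : set E) n (e : n.-tuple W) (M : E -> 'M[R]_n) :
  (forall b a, rational U (fun x => M x b a)) ->
  vrational U (fun x => mx_endo e (M x)).
Proof.
move=> rM; apply: vrational_sum => b; apply: vrational_sum => a.
exact: vrational_scale.
Qed.

(** * The graded orthogonal group as the invariance group of the form, and its closedness *)

Section OrthogonalGroup.
Context {R : realType} {V : int -> vectType R} {l : int} {g : gform V}.
Hypothesis hg : graded_metric l g.

Definition form_invariant (A : deg0_end V) :=
  forall i j v w, g i j (A i v) (A j w) = g i j v w.

Lemma form_invariant_degree (A : deg0_end V) :
  (forall i j, i + j + l = 0 ->
    forall v w, g i j (A i v) (A j w) = g i j v w) -> form_invariant A.
Proof.
move=> gA i j v w; have [/gA|ijl] := eqVneq (i + j + l) 0; first exact.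
by rewrite !(gm_degree hg).
Qed.

(** The sign in [gflat] is nonzero and cancels, so the defining equation says that the pairing of
    [V_j] with [V_(-(j+l))] is preserved; the other components of [g] vanish. *)
Lemma O_gradedE : lg_set (O_graded l g) = @GL_graded R V `&` form_invariant.
Proof.
have flatE j v w : gflat l g j v w
    = ((-1) ^ ((j + 1) * l) : R) * g j (- (j + l)) v w.
  by rewrite /gflat !lfunE.
apply/seteqP; split=> A [GA OA]; split=> //.
  apply: form_invariant_degree => j i ijl v w.
  have iE : i = - (j + l) by apply/eqP; rewrite -addr_eq0 addrCA addrA ijl.
  subst i.
  have /lfunP/(_ v)/lfunP/(_ w) := OA j.
  rewrite !comp_lfunE lfun_dualE comp_lfunE !flatE.
  by apply: mulfI; rewrite expfz_neq0// oppr_eq0 oner_eq0.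
move=> j; apply/lfunP => v; apply/lfunP => w.
by rewrite !comp_lfunE lfun_dualE comp_lfunE !flatE OA.
Qed.

Lemma lg_units_O_graded : lg_units (O_graded l g) = @GL_graded R V.
Proof.
apply/seteqP; split=> [A [B [AB BA]] j|A GA].
  have ABj : (A j \o B j)%VF = \1%VF := congr1 (fun Z : deg0_end V => Z j) AB.
  have BAj : (B j \o A j)%VF = \1%VF := congr1 (fun Z : deg0_end V => Z j) BA.
  by exists (B j) => v; rewrite -comp_lfunE ?ABj ?BAj id_lfunE.
have kA j : lker (A j) == 0%VS by apply/lker0P/bij_inj.
exists (fun j => (A j)^-1%VF); split; apply: functional_extensionality_dep => j.
  exact: lker0_compfV.
exact: lker0_compVf.
Qed.

Lemma linear_lie_group_O_graded (cV : coordinatized (deg0_end V)) :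
  linear_lie_group (O_graded l g).
Proof.
split.
- move=> a x y z; apply: functional_extensionality_dep => j.
  transitivity (a *: (x j \o z j) + (y j \o z j))%VF => //.
  by rewrite comp_lfunZl -comp_lfunDl.
- move=> a x y z; apply: functional_extensionality_dep => j.
  transitivity (a *: (x j \o y j) + (x j \o z j))%VF => //.
  by rewrite comp_lfunZr -comp_lfunDr.
- by move=> x y z; apply: functional_extensionality_dep => j; exact: comp_lfunA.
- by move=> x; apply: functional_extensionality_dep => j; exact: comp_lfun1l.
- by move=> x; apply: functional_extensionality_dep => j; exact: comp_lfun1r.
- rewrite O_gradedE; split=> [j|i j v w]; last by rewrite !id_lfunE.
  by exists id => v; rewrite id_lfunE.
- rewrite O_gradedE => A B [GA gA] [GB gB]; split=> [j|i j v w].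
    by apply: (eq_bij (bij_comp (GA j) (GB j))) => v; rewrite comp_lfunE.
  by rewrite !comp_lfunE gA gB.
- rewrite O_gradedE => A [GA gA]; move: (GA).
  rewrite -{1}lg_units_O_graded => -[B [AB BA]]; exists B; split=> //.
  have ABj j v : A j (B j v) = v.
    by have := congr1 (fun Z : deg0_end V => Z j v) AB; rewrite /= comp_lfunE id_lfunE.
  (* The inverse preserves [g] too: [A] may be applied to both arguments, where it undoes [B]. *)
  split=> [|i j v w]; last by rewrite -gA !ABj.
  by rewrite -lg_units_O_graded; exists A.
(* Invariance is the vanishing of these quadratic functions of [A]; invertibility is left to the
   units of the algebra. *)
pose Q := [set q | exists i j v w,
  q = fun A : deg0_end V => g i j (A i v) (A j w) - g i j v w].
have [|n [c [C [ic clC CQ]]]] := rational_closed (Q := Q) cV.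
  move=> _ [i [j [v [w ->]]]].
  pose ev i (v : V i) (A : deg0_end V) := A i v.
  have evL i' v' : linear (ev i' v').
    move=> a x y; transitivity ((a *: x i' + y i') v') => //.
    by rewrite lfunE /= lfunE.
  pose evl i' v' := HB.pack_for {linear deg0_end V -> V i'} (ev i' v')
    (GRing.isLinear.Build _ _ _ _ (ev i' v') (evL i' v')).
  apply: rational_add; last exact: rational_cst.
  exact: (rational_bilinear setT (g i j) (evl i v) (evl j w)).
exists n, c, C; split=> //; rewrite lg_units_O_graded CQ O_gradedE.
apply/seteqP; split=> A [GA gA]; split=> //.
  by move=> _ [i [j [v [w ->]]]]; rewrite gA subrr.
move=> i j v w; apply/eqP; rewrite -subr_eq0; apply/eqP.
by apply: (gA (fun A : deg0_end V => g i j (A i v) (A j w) - g i j v w)); exists i, j, v, w.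
Qed.

End OrthogonalGroup.

(** * The target group: symplectic matrices times general linear groups *)

Lemma OmegaK {R : realType} h : Omega R h *m Omega R h = - 1%:M.
Proof.
rewrite /Omega mulmx_block !mul0mx !mulmx0 mul1mx mulmx1 !(addr0, add0r).
by rewrite scalar_mx_block opp_block_mx oppr0.
Qed.

Section SymplecticLinear.
Context {R : realType} {V : int -> vectType R} {k : int} {m : nat}.

Lemma symplectic_inverse h (B : 'M[R]_(h + h)) :
  B^T *m Omega R h *m B = Omega R h ->
  exists C, [/\ C^T *m Omega R h *m C = Omega R h, B *m C = 1%:M & C *m B = 1%:M].
Proof.
(* Since [- Omega] is the inverse of [Omega], multiplying [SB] by it on the left gives
   [C *m B = 1%:M]. *)
move=> SB; pose C := - (Omega R h *m B^T *m Omega R h).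
have CB : C *m B = 1%:M.
  by rewrite /C mulNmx -!mulmxA (mulmxA B^T) SB OmegaK opprK.
have BC := mulmx1C CB; exists C; split=> //.
transitivity (C^T *m (B^T *m Omega R h *m B) *m C); first by rewrite SB.
by rewrite -!mulmxA BC mulmx1 mulmxA -trmx_mul BC trmx1 mul1mx.
Qed.

Lemma linear_lie_group_Sp_x_GL : coordinatized (blocks V k m) ->
  linear_lie_group (Sp_x_GL V k m).
Proof.
move=> cB; split.
- move=> a x y z; congr pair.
    transitivity (a *: (x.1 *m z.1) + y.1 *m z.1) => //.
    by rewrite scalemxAl -mulmxDl.
  apply: functional_extensionality_dep => i.
  transitivity (a *: (x.2 i *m z.2 i) + y.2 i *m z.2 i) => //.
  by rewrite scalemxAl -mulmxDl.
- move=> a x y z; congr pair.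
    transitivity (a *: (x.1 *m y.1) + x.1 *m z.1) => //.
    by rewrite scalemxAr -mulmxDr.
  apply: functional_extensionality_dep => i.
  transitivity (a *: (x.2 i *m y.2 i) + x.2 i *m z.2 i) => //.
  by rewrite scalemxAr -mulmxDr.
- move=> x y z; congr pair; first exact: mulmxA.
  by apply: functional_extensionality_dep => i; exact: mulmxA.
- move=> [x y]; congr pair; first exact: mul1mx.
  by apply: functional_extensionality_dep => i; exact: mul1mx.
- move=> [x y]; congr pair; first exact: mulmx1.
  by apply: functional_extensionality_dep => i; exact: mulmx1.
- by split=> [|i] /=; rewrite ?unitmx1// trmx1 mul1mx mulmx1.
- move=> x y [Sx ux] [Sy uy]; split=> [|i] /=; last by rewrite unitmx_mul ux uy.
  by rewrite trmx_mul -!mulmxA (mulmxA x.1^T) (mulmxA _ x.1) Sx mulmxA.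
- move=> [x y] [/symplectic_inverse[C [SC BC CB]] uy].
  exists (C, fun i => invmx (y i)); split.
  + by split=> // i; rewrite /= unitmx_inv.
  + congr pair => //; apply: functional_extensionality_dep => i.
    exact/mulmxV/uy.
  + congr pair => //; apply: functional_extensionality_dep => i.
    exact/mulVmx/uy.
(* Only the symplectic equation is imposed as a closed condition; invertibility of the other blocks
   comes from being a unit. *)
pose Q := [set q | exists a b, q = fun B : blocks V k m =>
  (B.1^T *m Omega R _ *m B.1) a b - Omega R _ a b].
have [|n [c [C [ic clC CQ]]]] := rational_closed (Q := Q) cB.
  move=> _ [a [b ->]]; apply: rational_add; last exact: rational_cst.
  have rB a' b' : rational setT (fun B : blocks V k m => B.1 a' b').
    exact: (rational_lin setT (mxentry a' b' \o fst)).
  under eq_fun do rewrite mxE; apply: rational_sum => j.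
  apply: rational_mul => //.
  under eq_fun do rewrite mxE; apply: rational_sum => j'.
  apply: rational_mul; last exact: rational_cst.
  by under eq_fun do rewrite mxE.
exists n, c, C; split=> //; rewrite CQ; apply/seteqP; split.
  move=> x [Sx ux]; split; last by move=> _ [a [b ->]]; rewrite Sx subrr.
  have [C' [_ BC CB]] := symplectic_inverse Sx.
  exists (C', fun i => invmx (x.2 i)); split; congr pair => //;
    apply: functional_extensionality_dep => i; [exact/mulmxV/ux|exact/mulVmx/ux].
move=> x [[y [xy yx]] Qx]; split=> [|i].
  apply/matrixP => a b; apply/eqP; rewrite -subr_eq0; apply/eqP.
  apply: (Qx (fun B : blocks V k m => (B.1^T *m Omega R _ *m B.1) a b - Omega R _ a b)).
  by exists a, b.
have : x.2 i *m y.2 i = 1%:M := congr1 (fun B : blocks V k m => B.2 i) xy.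
by case/mulmx1_unit.
Qed.

End SymplecticLinear.

(** * Assembling a graded endomorphism from blocks, and orthogonality in terms of blocks *)

Lemma dprod_sum {R : realType} (I J : Type) (W : I -> lmodType R) (r : seq J)
  (x : J -> dprod W) i : (\sum_(j <- r) x j) i = \sum_(j <- r) x j i.
Proof.
by elim: r => [|j r IHr]; rewrite ?big_nil// !big_cons -IHr.
Qed.

Lemma sum_dincl_in {R : realType} (I : eqType) (J : finType) (W : I -> lmodType R)
  (p : J -> I) (x : forall j, W (p j)) j :
  injective p -> (\sum_j dincl (x j)) (p j) = x j.
Proof.
move=> pI; rewrite dprod_sum (bigD1 j)//= dincl_in big1 ?addr0// => j' j'j.
by rewrite dincl_out// (inj_eq pI).
Qed.

Lemma sum_dincl_out {R : realType} (I : eqType) (J : finType) (W : I -> lmodType R)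
  (p : J -> I) (x : forall j, W (p j)) i :
  (forall j, p j != i) -> (\sum_j dincl (x j)) i = 0.
Proof. by move=> pi; rewrite dprod_sum big1// => j _; rewrite dincl_out. Qed.

Section StandardBasis.
Context {R : realType} {V : int -> vectType R} {k l : int} {g : gform V} {m : nat}.
Context (b : standard_basis g k m).

Let e0 := [tuple of sb_t0 b ++ sb_tb0 b].

Lemma block_matrices_linear : linear (block_matrices b).
Proof.
move=> a A A'; congr pair; first exact: linearP.
by apply: functional_extensionality_dep => i; exact: linearP.
Qed.

(* The inverse transpose is written with the adjugate rather than [invmx], which
   makes it a rational expression on the whole space of matrices. *)
Definition assemble (B : blocks V k m) : deg0_end V :=
  dincl (W := fun j => 'End(V j)) (mx_endo e0 B.1)
  + \sum_(i < m) dincl (W := fun j => 'End(V j)) (mx_endo (sb_t b i) (B.2 i))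
  + \sum_(i < m) dincl (W := fun j => 'End(V j))
      (mx_endo (sb_tb b i) ((\det (B.2 i))^-1 *: \adj (B.2 i))^T).

(** The degrees [k], [k + i.+1] and [k - i.+1] are pairwise distinct, so a single summand survives
    in each; the next two lemmas rest on the same fact. *)
Lemma assemble_mid B : assemble B k = mx_endo e0 B.1.
Proof.
transitivity (mx_endo e0 B.1 + 0 + 0); last by rewrite !addr0.
congr (_ + _ + _); first exact: dincl_in.
  by apply: sum_dincl_out => i; apply/eqP; lia.
by apply: sum_dincl_out => i; apply/eqP; lia.
Qed.

Lemma assemble_up B (i : 'I_m) :
  assemble B (k + i.+1%:Z) = mx_endo (sb_t b i) (B.2 i).
Proof.
transitivity (0 + mx_endo (sb_t b i) (B.2 i) + 0); last by rewrite addr0 add0r.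
congr (_ + _ + _); first by apply: dincl_out; apply/eqP; lia.
  apply: (sum_dincl_in (W := fun j => 'End(V j)) (p := fun i : 'I_m => k + i.+1%:Z)).
  by move=> i1 i2 i12; apply/val_inj => /=; lia.
by apply: sum_dincl_out => i'; apply/eqP; lia.
Qed.

Lemma assemble_down B (i : 'I_m) : assemble B (k - i.+1%:Z)
  = mx_endo (sb_tb b i) ((\det (B.2 i))^-1 *: \adj (B.2 i))^T.
Proof.
transitivity (0 + 0 + mx_endo (sb_tb b i) ((\det (B.2 i))^-1 *: \adj (B.2 i))^T);
  last by rewrite addr0 add0r.
congr (_ + _ + _); first by apply: dincl_out; apply/eqP; lia.
  by apply: sum_dincl_out => i'; apply/eqP; lia.
apply: (sum_dincl_in (W := fun j => 'End(V j)) (p := fun i : 'I_m => k - i.+1%:Z)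
  (fun i => mx_endo (sb_tb b i) ((\det (B.2 i))^-1 *: \adj (B.2 i))^T)).
by move=> i1 i2 i12; apply/val_inj => /=; lia.
Qed.

Lemma assembleK B : block_matrices b (assemble B) = B.
Proof.
case: B => B C; congr pair.
  by rewrite assemble_mid mx_endoK//; exact: sb_0_basis.
apply: functional_extensionality_dep => i.
by rewrite assemble_up mx_endoK//; exact: sb_t_basis.
Qed.

Lemma gram_mx_pair (i : 'I_m) : gram_mx (sb_t b i) (sb_tb b i) (g _ _) = 1%:M.
Proof. by apply/matrixP => a c; rewrite !mxE (sb_pair b). Qed.

Hypotheses (hl : l = - (2 * k)) (hg : graded_metric l g).
Hypothesis hmax : forall i : nat, (m < i)%N -> \dim {: V (k + i%:Z)} = 0%N.

(** Matching on an indexed family replaces the degree itself, which avoids casts between spaces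
    [V j] of equal degree. *)
Variant degree_spec : int -> Prop :=
| DegreeMid : degree_spec k
| DegreeUp (i : 'I_m) : degree_spec (k + i.+1%:Z)
| DegreeDown (i : 'I_m) : degree_spec (k - i.+1%:Z)
| DegreeNone j of (forall v : V j, v = 0) : degree_spec j.

Lemma degreeP j : degree_spec j.
Proof.
have dim0 i (v : V i) : \dim {: V i} = 0%N -> v = 0.
  by move=> /eqP; rewrite dimv_eq0 => /eqP V0; apply/eqP; rewrite -memv0 -V0 memvf.
have -> : j = k + (j - k) by rewrite addrC subrK.
case: (j - k) => [[|n]|n].
- by rewrite addr0; exact: DegreeMid.
- have [nm|mn] := ltnP n m; first exact: (DegreeUp (Ordinal nm)).
  by apply: DegreeNone => v; apply: dim0; exact: hmax.
have [nm|mn] := ltnP n m; first exact: (DegreeDown (Ordinal nm)).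
(* Below [k - m], nondegeneracy embeds [V_j] into the dual of [V_(2k-j)], which is zero because
   [2k - j > k + m]. *)
apply: DegreeNone => v; apply: (bij_inj (gm_iso hg _)); rewrite linear0.
apply/lfunP => w; rewrite [w]dim0 ?linear0//.
have -> : - (k + Negz n + l) = k + n.+1%:Z by lia.
exact: hmax.
Qed.

Lemma coordinatized_deg0_end : coordinatized (deg0_end V).
Proof.
apply: (coordinatized_dprod (s := k :: [seq k + i.+1%:Z | i : 'I_m]
    ++ [seq k - i.+1%:Z | i : 'I_m])) => [j|j]; first exact: coordinatized_vect.
case: (degreeP j) => [|i|i|{}j V0].
- by rewrite mem_head.
- by rewrite inE mem_cat (map_f _ (mem_enum _ i)) orbT.
- by rewrite inE mem_cat (map_f (fun i : 'I_m => k - i.+1%:Z) (mem_enum _ i)) !orbT.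
- by move=> _ f; apply/lfunP => v; rewrite [LHS]V0 [RHS]V0.
Qed.

Hypothesis hk : odd `|k|%N.

Lemma gram_mx_mid : gram_mx e0 e0 (g k k) = Omega R _.
Proof.
have skew v w : g k k v w = - g k k w v.
  (* Here [k + l = - k], so the sign is [(-1)^(k^2)], which is -1 for odd [k]. *)
  rewrite (gm_sym hg); have -> : (k + l) * (k + l) = (`|k| * `|k|)%N by nia.
  by rewrite -exprnP -signr_odd oddM hk expr1 mulN1r.
apply/matrixP => a c; rewrite mxE /Omega.
case: (split_ordP a) => {}a ->; case: (split_ordP c) => {}c ->;
  rewrite ?tnth_lshift ?tnth_rshift.
- by rewrite block_mxEul (sb_t0_isotropic b) mxE.
- by rewrite block_mxEur (sb_pair0 b) mxE.
- by rewrite block_mxEdl skew (sb_pair0 b) !mxE eq_sym.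
- by rewrite block_mxEdr (sb_tb0_isotropic b) mxE.
Qed.

(** Invariance is examined on each pair of degrees [j] and [2k - j]: the middle one gives the
    symplectic equation, the others the inverse transpose relation, which also makes [A_(k-i)]
    invertible. *)
Lemma O_graded_block_matrices (A : deg0_end V) :
  lg_set (O_graded l g) A <->
  lg_set (Sp_x_GL V k m) (block_matrices b A) /\
  forall i, (endo_mx (sb_t b i) (A _))^T *m endo_mx (sb_tb b i) (A _) = 1%:M.
Proof.
rewrite (O_gradedE hg); split=> [[GA gA]|[[SA uA] pA]].
  split=> [|i]; last first.
    (* The right-hand side and an identity inserted between the two factors are both read as the
       Gram matrix. *)
    rewrite -(gram_mx_pair i) -[X in X *m _]mulmx1 -(gram_mx_pair i).
    by apply/gram_mx_invariant; [exact: sb_t_basis|exact: sb_tb_basis|exact: gA].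
  split=> [|i] /=; last by apply/endo_mx_unit; [exact: sb_t_basis|exact: GA].
  rewrite -gram_mx_mid; apply/gram_mx_invariant; try exact: sb_0_basis.
  exact: gA.
split=> [j|].
  case: (degreeP j) => [|i|i|{}j V0].
  - have [C [_ BC CB]] := symplectic_inverse SA.
    apply/(endo_mx_unit (sb_0_basis b)).
    by case/mulmx1_unit: BC.
  - exact/(endo_mx_unit (sb_t_basis b i))/uA.
  - apply/(endo_mx_unit (sb_tb_basis b i)).
    by case/mulmx1_unit: (pA i).
  - by exists id => v; rewrite [LHS]V0 [RHS]V0.
have gA0 v w : g k k (A k v) (A k w) = g k k v w.
  move: v w; apply/(gram_mx_invariant (sb_0_basis b) (sb_0_basis b)).
  by rewrite gram_mx_mid; exact: SA.
have gAi (i : 'I_m) v w : g (k + i.+1%:Z) (k - i.+1%:Z) (A _ v) (A _ w) = g _ _ v w.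
  move: v w; apply/(gram_mx_invariant (sb_t_basis b i) (sb_tb_basis b i)).
  by rewrite gram_mx_pair mulmx1.
apply: (form_invariant_degree hg) => i j ijl v w.
(* [g] pairs a degree only with its mirror image about [k], so [i] determines [j]. *)
have jE : j = 2 * k - i by lia.
case: (degreeP i) v w ijl jE => [|s|s|{}i V0] v w ijl jE; last first.
- by rewrite [A i v]V0 [v]V0 linear0 !lfunE.
- have jE' : j = k + s.+1%:Z by lia.
  (* For [i] below [k], graded symmetry swaps the arguments to reach [gAi], and swapping back
     cancels the sign. *)
  by move: w; rewrite {}jE' => w; rewrite (gm_sym hg) gAi -(gm_sym hg).
- have jE' : j = k - s.+1%:Z by lia.
  by move: w; rewrite {}jE' => w; exact: gAi.
- have jE' : j = k by lia.
  by move: w; rewrite {}jE' => w; exact: gA0.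
Qed.

Lemma assemble_O_graded B :
  lg_set (Sp_x_GL V k m) B -> lg_set (O_graded l g) (assemble B).
Proof.
move=> SB; apply/O_graded_block_matrices; rewrite assembleK; split=> // i.
have ui := SB.2 i; rewrite assemble_up assemble_down.
rewrite !mx_endoK; [|exact: sb_tb_basis|exact: sb_t_basis].
(* On a unit matrix [invmx] unfolds to the adjugate formula used in [assemble]. *)
have := mulVmx ui; rewrite /invmx ui => VB.
by rewrite -trmx_mul VB trmx1.
Qed.

Lemma block_matricesK A :
  lg_set (O_graded l g) A -> assemble (block_matrices b A) = A.
Proof.
move=> /O_graded_block_matrices[[SA uA] pA].
apply: functional_extensionality_dep => j.
case: (degreeP j) => [|i|i|{}j V0].
- by rewrite assemble_mid endo_mxK//; exact: sb_0_basis.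
- by rewrite assemble_up endo_mxK//; exact: sb_t_basis.
- rewrite assemble_down -[RHS](endo_mxK (sb_tb_basis b i)); congr mx_endo.
  have ui := uA i; have := mulmxV ui; rewrite /invmx ui => BV.
  (* The relation [pA] forces the block in degree [k - i]: inserted to the right of the inverse
     transpose, it leaves just that block. *)
  rewrite -[LHS]mulmx1 -(pA i) mulmxA -trmx_mul BV trmx1.
  exact: mul1mx.
- by apply/lfunP => v; rewrite [LHS]V0 [RHS]V0.
Qed.

End StandardBasis.

(** * The isomorphism: bijectivity, multiplicativity and smoothness in both directions *)

Lemma coordinatized_blocks (R : realType) (V : int -> vectType R) k m :
  coordinatized (blocks V k m).
Proof.
apply: coordinatized_prod; first exact: coordinatized_vect.
apply: (coordinatized_dprod (s := enum 'I_m)) => [i|i].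
  exact: coordinatized_vect.
by rewrite mem_enum.
Qed.

Theorem proposition10p5 (R : realType) (V : int -> vectType R)
  (hfin : finite_graded V)
  (hV : exists j : int, \dim {: V j} != 0%N)
  (k l : int) (hk : odd `|k|%N) (hl : l = - (2 * k))
  (g : gform V) (hg : graded_metric l g)
  (m : nat)
  (hm : \dim {: V (k + m%:Z)} != 0%N)
  (hmax : forall i : nat, (m < i)%N -> \dim {: V (k + i%:Z)} = 0%N)
  (b : standard_basis g k m) :
  lie_group_isomorphism (O_graded l g) (Sp_x_GL V k m) (block_matrices b).
Proof.
have cE := coordinatized_deg0_end hl hg hmax.
have cB := coordinatized_blocks V k m.
have OE := O_graded_block_matrices b hl hg hmax hk.
have bK := block_matricesK b hl hg hmax hk.
split.
- split; first exact: linear_lie_group_O_graded.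
  exact: linear_lie_group_Sp_x_GL.
- split=> [A /OE[]//|A A' /set_mem OA /set_mem OA' AA'|B SB].
    by rewrite -(bK _ OA) AA' bK.
  by exists (assemble b B); [exact: assemble_O_graded|exact: assembleK].
- move=> A B OA OB; congr pair; first exact/endo_mx_comp/sb_0_basis.
  apply: functional_extensionality_dep => i.
  exact/endo_mx_comp/sb_t_basis.
- pose bl := HB.pack_for {linear deg0_end V -> blocks V k m} (block_matrices b)
    (GRing.isLinear.Build _ _ _ _ (block_matrices b) (block_matrices_linear b)).
  (* The map is linear, so the constant 1 serves as denominator. *)
  apply: (vrational_smooth (q := fun=> 1)) => //.
  + exact: rational_cst.
  + by move=> A _; exact: oner_neq0.
  + exact: (vrational_lin _ bl).
exists (assemble b); split; first exact: bK.
(* A common denominator for all the inverse transposes in [assemble]; it is nonzero on the group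
   because every [B.2 i] is invertible there. *)
pose q (B : blocks V k m) := \prod_(i < m) \det (B.2 i).
have qi (B : blocks V k m) i : q B != 0 -> \det (B.2 i) != 0.
  by move=> /prodf_neq0; exact.
pose entry i a c := @mxentry R _ _ a c \o (fun B : blocks V k m => B.2 i).
have entryL i a c : linear (entry i a c).
  by move=> x B C; rewrite /entry /mxentry /= !mxE.
pose entryl i a c := HB.pack_for {linear blocks V k m -> R^o} (entry i a c)
  (GRing.isLinear.Build _ _ _ _ (entry i a c) (entryL i a c)).
have rB2 (U : set (blocks V k m)) i a c : rational U (fun B => B.2 i a c).
  exact: (rational_lin U (entryl i a c)).
apply: (vrational_smooth (q := q)) => //.
- by apply: rational_prod => i; apply: rational_det => a c.
- move=> B [_ uB]; apply/prodf_neq0 => i _.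
  by have := uB i; rewrite unitmxE unitfE.
apply: vrational_add; first apply: vrational_add.
- apply: vrational_linl; apply: vrational_mx_endo => a c.
  exact: (rational_lin _ (mxentry a c \o fst)).
- apply: vrational_sum => i; apply: vrational_linl.
  by apply: vrational_mx_endo => a c.
apply: vrational_sum => i; apply: vrational_linl.
apply: vrational_mx_endo => a c; under [X in rational _ X]eq_fun do rewrite mxE.
by apply: rational_invmx => // B /qi.
Qed.
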